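(* Let $K$ be a field, $R=K[x_1,x_2,x_3,x_4]$ and $$I=(x_1x_2x_3,\;x_2^2x_3,\;x_2x_3^2,\;x_1x_2x_4,\;x_2^2x_4,\;x_2x_4^2,\;x_1x_3x_4,\;x_3^2x_4,\;x_3x_4^2,\;x_2x_3x_4).$$ Then $I$ is a polymatroidal ideal with $\operatorname{dstab}(I)=1$ and $\operatorname{astab}(I)=2$.
   Context: $G(I)$ denotes the unique minimal set of monomial generators of a monomial ideal $I$. A monomial ideal $I$ is polymatroidal if it is generated in a single degree and for any $u,v\in G(I)$ and any $i$ with $\deg_{x_i}(u)>\deg_{x_i}(v)$ there exists $j$ with $\deg_{x_j}(u)<\deg_{x_j}(v)$ and $x_j(u/x_i)\in I$; here $\deg_{x_i}(u)$ is the exponent of $x_i$ in $u$. $\operatorname{Ass}(I)$ denotes the set of associated primes of $R/I$. $\operatorname{astab}(I)$ is the smallest integer $k_0\ge 1$ such that $\operatorname{Ass}(I^k)=\operatorname{Ass}(I^{k_0})$ for all $k\ge k_0$. $\operatorname{dstab}(I)$ is the smallest integer $k_0\ge 1$ such that $\operatorname{depth} R/I^k=\operatorname{depth} R/I^{k_0}$ for all $k\ge k_0$ (both exist by results of Brodmann). *)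

(* Defs.v *)
From mathcomp Require Import all_boot all_order all_algebra.
From mathcomp Require Export mpoly.

Set Implicit Arguments.
Unset Strict Implicit.
Unset Printing Implicit Defensive.

Import GRing.Theory.
Local Open Scope ring_scope.

(* Ideals are Prop-valued predicates, since membership need not be computable
   over an arbitrary field. Elements of R/J are handled through their
   representatives in R. *)
Section Ideals.
Variable R : comNzRingType.
Implicit Types (I J P S m : R -> Prop) (s : seq R).

Definition ideal_span S : R -> Prop := fun f =>
  exists (n : nat) (c g : 'I_n -> R),
    (forall i, S (g i)) /\ f = \sum_(i < n) c i * g i.

Definition ideal_eq I J : Prop := forall f, I f <-> J f.

Definition ideal_mul I J : R -> Prop :=
  ideal_span (fun f => exists a b, [/\ I a, J b & f = a * b]).

Fixpoint ideal_pow I (k : nat) : R -> Prop :=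
  if k is k'.+1 then ideal_mul (ideal_pow I k') I else fun=> True.

Definition prime_ideal P : Prop :=
  [/\ P 0,
      (forall f g, P f -> P g -> P (f + g)),
      (forall f g, P g -> P (f * g)),
      ~ P 1
    & forall f g, P (f * g) -> P f \/ P g].

(* P \in Ass(R/I): P is a prime ideal and the annihilator of the class of
   some f in R/I. *)
Definition Ass I P : Prop :=
  prime_ideal P /\ exists f, forall g, P g <-> I (g * f).

(* The ideal J + (s). *)
Definition ideal_add_seq J s : R -> Prop :=
  ideal_span (fun f => J f \/ f \in s).

(* s = s_0, ..., s_(r-1) is a regular sequence on the module R/J: each s_i is
   a nonzerodivisor on R/(J + (s_0, ..., s_(i-1))), and R/(J + (s)) <> 0. *)
Definition regular_seq J s : Prop :=
  (forall i, (i < size s)%N -> forall f,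
     ideal_add_seq J (take i s) (s`_i * f) -> ideal_add_seq J (take i s) f)
  /\ ~ ideal_add_seq J s 1.

(* d is the maximal length of an (R/J)-regular sequence in m. *)
Definition is_depth m J (d : nat) : Prop :=
  (exists s, [/\ size s = d, (forall f, f \in s -> m f) & regular_seq J s])
  /\ (forall s, (forall f, f \in s -> m f) -> regular_seq J s ->
        (size s <= d)%N).

End Ideals.

(* k0 is the smallest integer >= 1 such that E k k0 for all k >= k0. *)
Definition is_stability_index (E : nat -> nat -> Prop) (k0 : nat) : Prop :=
  let stable_from k1 :=
    (1 <= k1)%N /\ forall k, (k1 <= k)%N -> E k k1 in
  stable_from k0 /\ forall k1, stable_from k1 -> (k0 <= k1)%N.

Definition is_astab (R : comNzRingType) (I : R -> Prop) : nat -> Prop :=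
  is_stability_index (fun k l =>
    forall P, Ass (ideal_pow I k) P <-> Ass (ideal_pow I l) P).

Section Polynomials.
Variables (K : fieldType) (n : nat).
Implicit Types (I : {mpoly K[n]} -> Prop) (G : 'X_{1..n} -> Prop).

Definition graded_max_ideal : {mpoly K[n]} -> Prop :=
  ideal_span (fun f => exists i : 'I_n, f = 'X_i).

(* As is standard in the graded setting, depth R/I^k is taken with respect to
   (x_1, ..., x_n). *)
Definition is_dstab I : nat -> Prop :=
  is_stability_index (fun k l => exists d,
    is_depth graded_max_ideal (ideal_pow I k) d /\
    is_depth graded_max_ideal (ideal_pow I l) d).

Definition monomial_span G : {mpoly K[n]} -> Prop :=
  ideal_span (fun f => exists u, G u /\ f = 'X_[u]).

(* G = G(I), a set of monomials being given by its exponent vectors; that such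
   a G exists says that I is a monomial ideal. *)
Definition is_min_gens I G : Prop :=
  ideal_eq (monomial_span G) I /\
  forall G' : 'X_{1..n} -> Prop, (forall u, G' u -> G u) ->
    ideal_eq (monomial_span G') I -> forall u, G u -> G' u.

(* Below (u - U_(i) + U_(j))%MM is the exponent of x_j (u / x_i); the
   subtraction is exact since u i > v i. *)
Definition polymatroidal I : Prop :=
  exists G, [/\ is_min_gens I G,
    (exists d : nat, forall u, G u -> mdeg u = d)
  & forall u v, G u -> G v -> forall i, (v i < u i)%N ->
      exists2 j, (u j < v j)%N & I 'X_[(u - U_(i) + U_(j))%MM]].

End Polynomials.

(* Main.v *)
Require Import Defs.
From mathcomp Require Import all_boot all_order all_algebra.
From mathcomp Require Import zify.

Set Implicit Arguments.
Unset Strict Implicit.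
Unset Printing Implicit Defensive.

Import GRing.Theory.
Local Open Scope ring_scope.

(** With a, b, c, d the exponents of x_1, x_2, x_3, x_4, a monomial lies in I^k
    (k >= 1) iff
      b + c >= k, b + d >= k, c + d >= k, b + c + d >= 2k, a + b + c + d >= 3k,
    since a monomial with these properties for k + 1 is a generator of I times
    one with these properties for k. Hence I^k is the intersection of the
    primary ideals P_A^e attached to these inequalities, where P_A is generated
    by the variables occurring in the inequality and e is its right-hand side.
    Every associated prime of I^k is then one of the five P_A, and P_A is
    associated as soon as some monomial w satisfies: w times a monomial u lies
    in I^k iff u is in P_A. The maximal ideal always occurs, by
    w = x_1^(k-1) x_2^k x_3^k, so the depth is 0. The prime (x_2, x_3, x_4)
    occurs for k >= 2, but for k = 1 its inequality follows from the first
    three. *)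

(** * Ideals spanned by a set, and a criterion for depth zero *)

Section IdealSpan.
Variable R : comNzRingType.
Implicit Types (S J : R -> Prop) (f g : R).

Lemma ideal_span_least S J :
    J 0 -> (forall f g, J f -> J g -> J (f + g)) ->
    (forall f g, J g -> J (f * g)) -> (forall f, S f -> J f) ->
  forall f, ideal_span S f -> J f.
Proof.
move=> J0 JD JM SJ _ [n [c [g [Sg ->]]]].
by elim/big_ind: _ => // i _; apply/JM/SJ.
Qed.

Lemma ideal_span_gen S f : S f -> ideal_span S f.
Proof.
move=> Sf; exists 1%N, (fun=> 1), (fun=> f).
by split=> //; rewrite big_ord1 mul1r.
Qed.

Lemma ideal_span0 S : ideal_span S 0.
Proof.
by exists 0%N, (fun=> 0), (fun=> 0); split=> [[]|]; rewrite ?big_ord0.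
Qed.

Lemma ideal_spanM S f g : ideal_span S g -> ideal_span S (f * g).
Proof.
move=> [n [c [h [Sh ->]]]]; exists n, (fun i => f * c i), h; split=> //.
by rewrite mulr_sumr; apply: eq_bigr => i _; rewrite mulrA.
Qed.

Lemma ideal_spanD S f g :
  ideal_span S f -> ideal_span S g -> ideal_span S (f + g).
Proof.
move=> [m [c [u [Su ->]]]] [n [d [v [Sv ->]]]].
pose glue T (a : 'I_m -> T) (b : 'I_n -> T) (i : 'I_(m + n)) : T :=
  match split i with inl j => a j | inr j => b j end.
exists (m + n)%N, (glue _ c d), (glue _ u v); split.
  by move=> i; rewrite /glue; case: (split i).
rewrite big_split_ord; congr (_ + _); apply: eq_bigr => i _.
  by rewrite /glue (unsplitK (inl i)).
by rewrite /glue (unsplitK (inr i)).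
Qed.

Lemma ideal_span_mono S S' f :
  (forall g, S g -> ideal_span S' g) -> ideal_span S f -> ideal_span S' f.
Proof.
move=> sSS'; apply: ideal_span_least => //; first exact: ideal_span0.
  exact: ideal_spanD.
exact: ideal_spanM.
Qed.

Lemma Ass_ext I J P : ideal_eq I J -> Ass I P -> Ass J P.
Proof.
move=> eqIJ [prP [f Pf]]; split=> //; exists f => g.
by rewrite Pf; apply: eqIJ.
Qed.

Lemma regular_seq_nil J : ideal_eq (ideal_span J) J -> ~ J 1 ->
  regular_seq J [::].
Proof.
move=> idJ J1; split=> // J1'; apply: J1; apply/idJ.
by apply: ideal_span_mono J1' => g []// Jg; apply: ideal_span_gen.
Qed.

(** The class of [w] is a nonzero element of R/J killed by [m], so no element of [m] can begin a
    regular sequence. *)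
Lemma depth0 m J w :
    ideal_eq (ideal_span J) J -> ~ J w -> (forall f, m f -> J (f * w)) ->
  is_depth m J 0.
Proof.
move=> idJ Jw mw; split.
  exists [::]; split=> //; apply: regular_seq_nil => // J1; apply: Jw.
  by rewrite -[w]mulr1; apply/idJ/ideal_spanM/ideal_span_gen.
case=> // f s ms [regs _]; case: Jw; apply/idJ.
have: ideal_add_seq J (take 0 (f :: s)) w.
  apply: (regs 0%N) => //=; apply: ideal_span_gen; left; apply: mw.
  by apply: ms; rewrite inE eqxx.
by apply: ideal_span_mono => g []//; apply: ideal_span_gen.
Qed.

End IdealSpan.

(** * Powers of monomial primes, through weighted orders *)

Section WeightedOrder.
Variables (K : fieldType) (n : nat).
Implicit Types (A : seq 'I_n) (m : 'X_{1..n}) (f g : {mpoly K[n]}).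

Definition weight A m := (\sum_(i <- A) m i)%N.

(** For [A] without repetition, this is a boolean test for membership in the [c]-th power of the
    prime generated by the x_i with i in [A]. *)
Definition order_ge A c f := all (fun m => c <= weight A m)%N (msupp f).

Lemma weight0 A : weight A 0%MM = 0%N.
Proof. by rewrite /weight big1 // => i _; rewrite mnm0E. Qed.

Lemma weight1 A i : weight A U_(i)%MM = count_mem i A.
Proof.
rewrite /weight -sum1_count [RHS]big_mkcond; apply: eq_bigr => j _.
by rewrite mnm1E /= eq_sym; case: (j == i).
Qed.

(* The substitution x_i := x_i t for i in A, so that order_ge A c f says that
   t^c divides the image of f. *)
Definition grade_subst A : {mpoly K[n]} -> {poly {mpoly K[n]}} :=
  mmap (polyC \o @mpolyC n K)
       (fun i => 'X_i *: 'X^(count_mem i A)).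

Lemma coef_grade_subst A f j :
  (grade_subst A f)`_j =
  \sum_(m <- msupp f | weight A m == j) f@_m *: 'X_[m].
Proof.
rewrite [RHS]big_mkcond coef_sum; apply: eq_bigr => m _.
rewrite coefCM.
have -> : mmap1 (fun i => 'X_i *: 'X^(count_mem i A)) m
          = 'X_[m] *: 'X^(weight A m) :> {poly {mpoly K[n]}}.
  rewrite /mmap1 mpolyXE_id.
  under eq_bigr do rewrite exprZn -exprM.
  rewrite scaler_prod; congr (_ *: _); rewrite -expr_sum; congr (_ ^+ _).
  rewrite /weight; elim: A => [|a A IH]; first by rewrite big_nil big1.
  rewrite big_cons -IH; under eq_bigr do rewrite /= mulnDl.
  rewrite big_split /= (bigD1 a) //= eqxx mul1n big1 ?addn0 // => i.
  by rewrite eq_sym => /negPf ->.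
rewrite coefZ coefXn -mul_mpolyC eq_sym.
by case: eqP; rewrite ?mulr1 ?mulr0.
Qed.

Lemma order_geP A c f :
  reflect (forall j, (j < c)%N -> (grade_subst A f)`_j = 0) (order_ge A c f).
Proof.
apply: (iffP allP) => [ge_c j lt_jc | coef0 m fm].
  rewrite coef_grade_subst big_seq_cond big1 // => m /andP[/ge_c + /eqP].
  by move=> /[swap] ->; rewrite leqNgt lt_jc.
(* Distinct monomials of the same weight do not cancel, so the coefficient of [m] in [f] survives in
   degree [weight A m]. *)
rewrite leqNgt; apply/negP => /coef0 /(congr1 (mcoeff m)).
rewrite coef_grade_subst raddf_sum mcoeff0 /= => /eqP.
rewrite -big_filter (bigD1_seq m) ?filter_uniq ?msupp_uniq //=; last first.
  by rewrite mem_filter eqxx.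
rewrite mcoeffZ mcoeffX eqxx mulr1 big1 ?addr0.
  by rewrite mcoeff_eq0 fm.
by move=> m' ne; rewrite mcoeffZ mcoeffX (negPf ne) mulr0.
Qed.

Lemma grade_substM A f g :
  grade_subst A (f * g) = grade_subst A f * grade_subst A g.
Proof. exact: rmorphM. Qed.

Lemma order_ge0 A c : order_ge A c 0.
Proof. by rewrite /order_ge msupp0. Qed.

Lemma order_ge_wt0 A f : order_ge A 0 f.
Proof. exact/allP. Qed.

Lemma order_geD A c f g :
  order_ge A c f -> order_ge A c g -> order_ge A c (f + g).
Proof.
move=> /allP fc /allP gc; apply/allP => m /msuppD_le.
by rewrite mem_cat => /orP[/fc|/gc].
Qed.

Lemma order_geM A c d f g :
  order_ge A c f -> order_ge A d g -> order_ge A (c + d) (f * g).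
Proof.
move=> /order_geP fc /order_geP gd; apply/order_geP => j lt_j.
rewrite grade_substM.
move: (grade_subst A f) (grade_subst A g) fc gd => p q pc qd.
rewrite coefM big1 // => -[i /= le_ij] _.
have [/pc->|le_ci] := ltnP i c; first by rewrite mul0r.
rewrite qd ?mulr0 // ltn_subLR //.
by rewrite (leq_trans lt_j) // leq_add2r.
Qed.

Lemma order_geMl A c f g : order_ge A c g -> order_ge A c (f * g).
Proof. exact: order_geM (order_ge_wt0 A f). Qed.

Lemma order_ge_span A c (S : {mpoly K[n]} -> Prop) f :
  (forall g, S g -> order_ge A c g) -> ideal_span S f -> order_ge A c f.
Proof.
move=> Sc; apply: (ideal_span_least (J := fun g => order_ge A c g)) => //.
  exact: order_ge0.
  by move=> *; apply: order_geD.
exact: order_geMl.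
Qed.

Lemma order_geX A c m : order_ge A c 'X_[m] = (c <= weight A m)%N.
Proof. by rewrite /order_ge msuppX /= andbT. Qed.

(** The image of [f] has a nonzero constant coefficient in a domain, so the low coefficients of the
    image of [g] vanish one after the other. *)
Lemma order_ge_primary A c f g :
  ~~ order_ge A 1 f -> order_ge A c (f * g) -> order_ge A c g.
Proof.
move=> f1 /order_geP fgc; apply/order_geP => j.
have nz_f : (grade_subst A f)`_0 != 0.
  by apply: contraNneq f1 => f0; apply/order_geP => -[].
have {fgc}: forall j, (j < c)%N -> (grade_subst A f * grade_subst A g)`_j = 0.
  by move=> k; rewrite -grade_substM; apply: fgc.
move: (grade_subst A f) (grade_subst A g) nz_f => p q nz_p pqc.
elim/ltn_ind: j => j IH lt_jc.
have := pqc j lt_jc; rewrite coefM big_ord_recl subn0 big1.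
  by rewrite addr0 => /eqP; rewrite mulf_eq0 (negPf nz_p) => /eqP.
move=> i _; have lt_ij : (j - bump 0 i < j)%N.
  by rewrite ltn_subrL (leq_ltn_trans _ (ltn_ord i)).
by rewrite IH ?mulr0 // (ltn_trans lt_ij).
Qed.

Lemma order_ge1 A c : order_ge A c 1 = (c == 0%N).
Proof. by rewrite -mpolyX0 order_geX weight0 leqn0. Qed.

(** Primality is the case [c = 1] of [order_ge_primary]. *)
Lemma prime_order_ge A P :
  (forall f, P f <-> order_ge A 1 f) -> prime_ideal P.
Proof.
move=> defP; split.
- by apply/defP/order_ge0.
- by move=> f g /defP fP /defP gP; apply/defP/order_geD.
- by move=> f g /defP gP; apply/defP/order_geMl.
- by move=> /defP; rewrite order_ge1.
move=> f g /defP fgP; have [fP|fP] := boolP (order_ge A 1 f).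
  by left; apply/defP.
by right; apply/defP; apply: order_ge_primary fP fgP.
Qed.

Lemma prime_order_ge_sub A (P : {mpoly K[n]} -> Prop) :
    prime_ideal P -> (forall i, i \in A -> P 'X_i) ->
  forall f, order_ge A 1 f -> P f.
Proof.
move=> [P0 PD PM _ _] PA f /allP f1; rewrite [f]mpolyE big_seq.
elim/big_ind: _ => // m /f1; rewrite /weight lt0n sum_nat_seq_neq0.
case/hasP => i iA /= mi_neq0; rewrite -mul_mpolyC; apply: (PM).
have le_im : (U_(i) <= m)%MM by rewrite lep1mP.
by rewrite -(submK le_im) mpolyXD; apply/PM/PA.
Qed.

(** * Intersections of such powers and their associated primes *)

Implicit Type s : seq (seq 'I_n * nat).

(* The pair (A, c) stands for the c-th power of the prime generated by the x_i
   with i in A, and s for the intersection of these powers. *)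
Definition in_orders s f := all (fun a => order_ge a.1 a.2 f) s.

Definition mnm_in_orders s m := all (fun a => a.2 <= weight a.1 m)%N s.

Lemma in_ordersE s f : in_orders s f = all (mnm_in_orders s) (msupp f).
Proof.
apply/allP/allP => [fs m fm | fs a sa].
  by apply/allP => a /fs/allP; apply.
by apply/allP => m /fs/allP; apply.
Qed.

Lemma in_orders_span s (S : {mpoly K[n]} -> Prop) f :
  (forall g, S g -> in_orders s g) -> ideal_span S f -> in_orders s f.
Proof.
move=> Ss Sf; apply/allP => a sa; apply: order_ge_span Sf => g /Ss/allP.
exact.
Qed.

Lemma in_ordersX s m : in_orders s 'X_[m] = mnm_in_orders s m.
Proof. by rewrite in_ordersE msuppX /= andbT. Qed.

Lemma in_ordersMX s f m :
  in_orders s (f * 'X_[m])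
  = all (fun m' => mnm_in_orders s (m + m')%MM) (msupp f).
Proof. by rewrite in_ordersE (perm_all _ (msuppMX _ _)) all_map. Qed.

(* Each order_ge A c is primary to the prime order_ge A 1, so in_orders s is a
   primary decomposition. *)
Lemma Ass_in_orders s P : Ass (in_orders s) P ->
  exists2 A, A \in unzip1 s & forall f, P f <-> order_ge A 1 f.
Proof.
case=> prP [f Pf]; pose p g := in_orders s (g * f).
(* If some component misses [f] while all its variables lie in [P], then [P] is the prime of that
   component: one inclusion comes from the variables, the other from primariness. *)
have [] := boolP (has (fun a => ~~ order_ge a.1 a.2 f
                             && all (fun i => p 'X_i) a.1) s).
  case/hasP => -[A c] sa /= /andP[fc /allP PA].
  exists A; first by apply/mapP; exists (A, c).
  move=> g; split; last by apply: prime_order_ge_sub => // i /PA /Pf.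
  move=> /Pf/allP/(_ _ sa) /= gfc; apply: contraNT fc => g1.
  exact: order_ge_primary g1 gfc.
(* Otherwise each component has a multiplier outside [P] taking [f] into it, namely 1 or a power of
   a variable. The product of these multipliers is outside [P] but annihilates the class of [f]. *)
move=> /hasPn no_a; exfalso; case: prP => P0 PD PM P1 prP.
suff [g Pg /Pf] : exists2 g, ~ P g & in_orders s (g * f) by [].
have {no_a}: {in s, forall a, exists2 g, ~ P g & order_ge a.1 a.2 (g * f)}.
  move=> [A c] /no_a /=; rewrite negb_and negbK => /orP[fc | /allPn[i iA]].
    by exists 1; rewrite ?mul1r.
  move=> Xi; exists ('X_i ^+ c).
    elim: c => [|c IH]; rewrite ?expr0 // exprS => /prP[/Pf|//].
    exact/negP.
  rewrite mulrC; apply: order_geMl; rewrite mpolyXn order_geX.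
  rewrite /weight; under eq_bigr do rewrite mulmnE.
  rewrite -big_distrl leq_pmull // -/(weight A _) weight1.
  by rewrite -has_count has_pred1.
elim: s {Pf p} => [|a s IH] sP; first by exists 1.
have [|g Pg gs] := IH; first by move=> b sb; apply: sP; rewrite inE sb orbT.
have [h Ph ha] := sP a (mem_head _ _).
exists (h * g); first by case/prP.
apply/andP; split; first by rewrite [h * g]mulrC -mulrA order_geMl.
by rewrite -mulrA; apply/allP => b /(allP gs); apply: order_geMl.
Qed.

(** Membership is tested on monomials, so the hypothesis on [w] determines the whole annihilator of
    the class of ['X_[w]]. *)
Lemma in_orders_Ass s A w P :
    (forall m, mnm_in_orders s (w + m)%MM = (0 < weight A m)%N) ->
  (forall f, P f <-> order_ge A 1 f) -> Ass (in_orders s) P.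
Proof.
move=> Aw defP; split; first exact: prime_order_ge defP.
exists 'X_[w] => g; rewrite defP in_ordersMX /order_ge.
by rewrite (eq_all Aw).
Qed.

Lemma in_orders_sub s (S : {mpoly K[n]} -> Prop) f :
    (forall m, mnm_in_orders s m -> ideal_span S 'X_[m]) ->
  in_orders s f -> ideal_span S f.
Proof.
move=> sS; rewrite in_ordersE => /allP fs; rewrite [f]mpolyE big_seq.
elim/big_ind: _ => [||m /fs/sS Sm]; first exact: ideal_span0.
  exact: ideal_spanD.
by rewrite -mul_mpolyC; apply: ideal_spanM.
Qed.

(** A candidate for the [k]-th power of the intersection. It always contains that power; for
    [facets] the converse rests on [gens_divide]. *)
Definition scale k s := [seq (a.1, k * a.2)%N | a <- s].

Lemma in_orders_scaleM s k l f g :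
    in_orders (scale k s) f -> in_orders (scale l s) g ->
  in_orders (scale (k + l) s) (f * g).
Proof.
rewrite /in_orders !all_map => /allP fk /allP gl; apply/allP => a sa /=.
by rewrite mulnDl; apply: order_geM; [apply: fk | apply: gl].
Qed.

Lemma monomial_span_supp (G : 'X_{1..n} -> Prop) f :
    monomial_span G f ->
  {in msupp f, forall m, exists2 u, G u & (u <= m)%MM}.
Proof.
move: f; apply: (ideal_span_least (J := fun f =>
    {in msupp f, forall m, exists2 u, G u & (u <= m)%MM}))
  => [m|f g fG gG m|f g gG m|f [u [Gu ->]] m].
- by rewrite msupp0.
- by move=> /msuppD_le; rewrite mem_cat => /orP[/fG|/gG].
- move=> /msuppM_le /allpairsP[[m1 m2] /= [_ /gG[u Gu le_u] ->]].
  exists u => //; apply/mnm_lepP => i; rewrite mnmDE.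
  by move/mnm_lepP: le_u => /(_ i) /leq_trans; apply; apply: leq_addl.
- by rewrite msuppX inE => /eqP ->; exists u => //; apply/mnm_lepP.
Qed.

Lemma mnm_le_mdeg_eq (u m : 'X_{1..n}) :
  (u <= m)%MM -> mdeg u = mdeg m -> u = m.
Proof.
move=> le_um eq_deg; rewrite -(submK le_um).
suff /eqP -> : (m - u)%MM == 0%MM by rewrite add0m.
have := mdegD (m - u) u; rewrite submK // -eq_deg -mdeg_eq0; lia.
Qed.

End WeightedOrder.

(** * The inequalities that describe the powers of I *)

Local Notation i0 := (@Ordinal 4 0 isT).
Local Notation i1 := (@Ordinal 4 1 isT).
Local Notation i2 := (@Ordinal 4 2 isT).
Local Notation i3 := (@Ordinal 4 3 isT).

Lemma ord4_ind (P : 'I_4 -> Prop) :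
  P i0 -> P i1 -> P i2 -> P i3 -> forall i, P i.
Proof.
by move=> ? ? ? ? [[|[|[|[|//]]]] lt_i4]; rewrite (bool_irrelevance lt_i4 isT).
Qed.

Section PowersOfI.
Variable K : fieldType.
Local Open Scope nat_scope.

Definition facets : seq (seq 'I_4 * nat) :=
  [:: ([:: i1; i2], 1); ([:: i1; i3], 1); ([:: i2; i3], 1);
      ([:: i1; i2; i3], 2); ([:: i0; i1; i2; i3], 3)].

Definition gens : seq 'X_{1..4} :=
  [:: U_(i0) + U_(i1) + U_(i2); U_(i1) *+ 2 + U_(i2); U_(i1) + U_(i2) *+ 2;
      U_(i0) + U_(i1) + U_(i3); U_(i1) *+ 2 + U_(i3); U_(i1) + U_(i3) *+ 2;
      U_(i0) + U_(i2) + U_(i3); U_(i2) *+ 2 + U_(i3); U_(i2) + U_(i3) *+ 2;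
      U_(i1) + U_(i2) + U_(i3)]%MM.

Lemma mnm_in_facetsE k m : mnm_in_orders (scale k facets) m =
  [&& k <= m i1 + m i2, k <= m i1 + m i3, k <= m i2 + m i3,
      2 * k <= m i1 + m i2 + m i3 & 3 * k <= m i0 + m i1 + m i2 + m i3].
Proof.
rewrite /mnm_in_orders /= /weight !big_cons !big_nil; lia.
Qed.

Local Ltac choose_gen u :=
  exists u; [by rewrite /gens !inE eqxx ?orbT
            | by rewrite !(mnmDE, mulmnE, mnm1E) /=; lia].

(* If x_1 divides the monomial, take off x_1 and the two of x_2, x_3, x_4 with
   the largest exponents. Otherwise take off p^2 q, where p and q are these two
   variables in decreasing order of the exponents; this fails only for
   x_2 x_3 x_4 itself. *)
Lemma gens_divide k m : mnm_in_orders (scale k.+1 facets) m ->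
  exists u, [/\ u \in gens, (u <= m)%MM
             & mnm_in_orders (scale k facets) (m - u)%MM].
Proof.
rewrite mnm_in_facetsE => mk.
(* The conditions on [m - u] are stated with additions, to avoid truncated subtraction. *)
suff [u gu /and3P[/and4P[? ? ? ?] m12 mrest]] : exists2 u, u \in gens &
    [&& [&& u i0 <= m i0, u i1 <= m i1, u i2 <= m i2 & u i3 <= m i3],
       k + (u i1 + u i2) <= m i1 + m i2,
       k + (u i1 + u i3) <= m i1 + m i3,
       k + (u i2 + u i3) <= m i2 + m i3,
       2 * k + (u i1 + u i2 + u i3) <= m i1 + m i2 + m i3
     & 3 * k + (u i0 + u i1 + u i2 + u i3) <= m i0 + m i1 + m i2 + m i3].
  exists u; split=> //; first by apply/mnm_lepP; elim/ord4_ind.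
  by rewrite mnm_in_facetsE !mnmBE; lia.
have [a0 | a_gt0] := posnP (m i0); last first.
  have [le_bc | lt_cb] := leqP (m i1) (m i2).
    have [le_bd | lt_db] := leqP (m i1) (m i3).
      by choose_gen (U_(i0) + U_(i2) + U_(i3))%MM.
    by choose_gen (U_(i0) + U_(i1) + U_(i2))%MM.
  have [le_cd | lt_dc] := leqP (m i2) (m i3).
    by choose_gen (U_(i0) + U_(i1) + U_(i3))%MM.
  by choose_gen (U_(i0) + U_(i1) + U_(i2))%MM.
have [/and3P[/eqP b1 /eqP c1 /eqP d1] | n111] :=
    boolP [&& m i1 == 1, m i2 == 1 & m i3 == 1].
  by choose_gen (U_(i1) + U_(i2) + U_(i3))%MM.
have [le_bc | lt_cb] := leqP (m i1) (m i2);
  have [le_bd | lt_db] := leqP (m i1) (m i3);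
  have [le_cd | lt_dc] := leqP (m i2) (m i3).
- by choose_gen (U_(i2) + U_(i3) *+ 2)%MM.
- by choose_gen (U_(i2) *+ 2 + U_(i3))%MM.
(* Here c <= d < b <= c, a contradiction; the other such case is c < b <= d < c. *)
- by lia.
- by choose_gen (U_(i1) + U_(i2) *+ 2)%MM.
- by choose_gen (U_(i1) + U_(i3) *+ 2)%MM.
- by lia.
- by choose_gen (U_(i1) *+ 2 + U_(i3))%MM.
- by choose_gen (U_(i1) *+ 2 + U_(i2))%MM.
Qed.

(** The three pair inequalities add up to 2(b + c + d) >= 3, hence b + c + d >= 2 by integrality. *)
Lemma mnm_in_facets1E m : mnm_in_orders (scale 1 facets) m =
  [&& 0 < m i1 + m i2, 0 < m i1 + m i3, 0 < m i2 + m i3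
    & 3 <= m i0 + m i1 + m i2 + m i3].
Proof. by rewrite mnm_in_facetsE; lia. Qed.

Lemma mdeg4E (m : 'X_{1..4}) : mdeg m = m i0 + m i1 + m i2 + m i3.
Proof.
rewrite mdegE !big_ord_recl big_ord0 addn0 !addnA.
by congr (m _ + m _ + m _ + m _); apply/val_inj.
Qed.

Lemma gens_in_facets u :
  u \in gens -> mnm_in_orders (scale 1 facets) u && (mdeg u == 3).
Proof.
move: u; apply/allP; under eq_all do rewrite mnm_in_facets1E.
rewrite /= !mdegD ?mdegMn !mdeg1.
by rewrite !(mnmDE, mulmnE, mnm1E).
Qed.

Definition I_gens : {mpoly K[4]} -> Prop :=
  fun f => f \in [seq 'X_[u] | u <- gens].

Lemma ideal_I_inE f : ideal_span I_gens f <-> in_orders (scale 1 facets) f.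
Proof.
split.
  apply: in_orders_span => _ /mapP[u /gens_in_facets/andP[uI _] ->].
  by rewrite in_ordersX.
apply: in_orders_sub => m /gens_divide[u [gu le_um _]].
rewrite -(submK le_um) mpolyXD; apply/ideal_spanM/ideal_span_gen.
by apply/mapP; exists u.
Qed.

Lemma Ipow_inE k f :
  ideal_pow (ideal_span I_gens) k f <-> in_orders (scale k facets) f.
Proof.
elim: k f => [|k IH] f.
  (* For exponent 0 all right-hand sides are 0, and both sides are the whole ring. *)
  split=> // _; rewrite in_ordersE; apply/allP => m _.
  by rewrite mnm_in_facetsE.
split.
  apply: in_orders_span => _ [a [b [/IH ak /ideal_I_inE bI ->]]].
  by rewrite -(addn1 k); apply: in_orders_scaleM.
apply: in_orders_sub => m /gens_divide[u [gu le_um mk]].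
rewrite -(submK le_um) mpolyXD; apply: ideal_span_gen.
exists 'X_[m - u], 'X_[u]; split=> //; first by apply/IH; rewrite in_ordersX.
by apply: ideal_span_gen; apply/mapP; exists u.
Qed.

(** * The exchange property *)

Lemma polymatroidal_I : polymatroidal (ideal_span I_gens).
Proof.
(* Describing G(I) by inequalities instead of by the list turns the exchange property into linear
   arithmetic. *)
pose G u := mnm_in_orders (scale 1 facets) u && (mdeg u == 3).
exists G; split.
- split.
    move=> f; split.
      move=> Gf; apply/ideal_I_inE.
      apply: in_orders_span Gf => _ [u [/andP[uI _] ->]].
      by rewrite in_ordersX.
    apply: ideal_span_mono => _ /mapP[u gu ->]; apply: ideal_span_gen.
    by exists u; split=> //; apply: gens_in_facets.
  move=> G' sG'G eqG' u Gu.
  have /eqG' : ideal_span I_gens 'X_[u].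
    by case/andP: Gu => uI _; apply/ideal_I_inE; rewrite in_ordersX.
  (* Some [v] in [G'] divides [u]; both have degree 3, so they are equal. *)
  move/monomial_span_supp => /(_ u); rewrite msuppX mem_head => /(_ isT)[v G'v].
  move=> /mnm_le_mdeg_eq <- //.
  by case/andP: Gu (sG'G _ G'v) => _ /eqP -> /andP[_ /eqP ->].
- by exists 3 => u /andP[_ /eqP].
move=> u v /andP[uI /eqP du] /andP[vI /eqP dv] i lt_vu.
suff /existsP[j /andP[lt_uv uvI]] :
    [exists j, (u j < v j)
       && mnm_in_orders (scale 1 facets) (u - U_(i) + U_(j))%MM].
  by exists j => //; apply/ideal_I_inE; rewrite in_ordersX.
(* For each of the four values of [i], failure of all four candidates [j] is an inconsistent linear
   system. *)
apply: contraT; rewrite negb_exists => /forallP Nj.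
move: (Nj i0) (Nj i1) (Nj i2) (Nj i3) uI vI du dv => {Nj}.
rewrite !mnm_in_facets1E !mdeg4E !(mnmDE, mnmBE, mnm1E).
move=> N0 N1 N2 N3 uI vI du dv.
by move: i lt_vu N0 N1 N2 N3; elim/ord4_ind => lt_vu /=;
  clear -lt_vu uI vI du dv; lia.
Qed.

(** * Depth of the powers *)

Lemma ideal_span_pow_I k :
  ideal_eq (ideal_span (ideal_pow (ideal_span I_gens) k))
           (ideal_pow (ideal_span I_gens) k).
Proof.
move=> f; split; last exact: ideal_span_gen.
move=> Jf; apply/Ipow_inE; apply: in_orders_span Jf => g.
by move/Ipow_inE.
Qed.

Definition mnm4 a b c d : 'X_{1..4} :=
  [multinom nth 0 [:: a; b; c; d] i | i < 4].

(** Meant for the power [k.+1]: its degree 3k + 2 is one too small, and the other four inequalities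
    hold. *)
Definition socle_mnm k := mnm4 k k.+1 k.+1 0.

Lemma socle_mnmP k m :
  mnm_in_orders (scale k.+1 facets) (socle_mnm k + m)%MM
  = (0 < weight [:: i0; i1; i2; i3] m).
Proof.
rewrite mnm_in_facetsE !mnmDE !mnmE /= /weight !big_cons big_nil; lia.
Qed.

Lemma depth_I k : 0 < k ->
  is_depth (@graded_max_ideal K 4) (ideal_pow (ideal_span I_gens) k) 0.
Proof.
case: k => // k _.
apply: (@depth0 _ _ _ 'X_[socle_mnm k] (@ideal_span_pow_I k.+1)).
  move/Ipow_inE; rewrite in_ordersX.
  by rewrite -[socle_mnm k]addm0 socle_mnmP weight0.
move=> f mf; apply/Ipow_inE; rewrite in_ordersMX (eq_all (socle_mnmP k)).
apply: order_ge_span mf => _ [i ->]; rewrite order_geX weight1.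
by move: i; elim/ord4_ind.
Qed.

Lemma dstab_I : is_dstab (ideal_span I_gens) 1.
Proof.
split; last by move=> k1 [].
by split=> // k k_gt0; exists 0; split; apply: depth_I.
Qed.

(** * Associated primes of the powers *)

Lemma Ass_pow_I k P : 2 <= k -> Ass (ideal_pow (ideal_span I_gens) k) P <->
  exists2 A, A \in unzip1 facets & forall f, P f <-> order_ge A 1 f.
Proof.
move=> k_ge2; split; first by move/(Ass_ext (@Ipow_inE k))/Ass_in_orders.
move=> [A FA defP]; suff: Ass (in_orders (scale k facets)) P.
  by apply: Ass_ext => f; rewrite Ipow_inE.
suff [w Aw] : exists w, forall m,
    mnm_in_orders (scale k facets) (w + m)%MM = (0 < weight A m).
  exact: in_orders_Ass Aw defP.
case: k k_ge2 => [//|k] k_gt0.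
move: FA; rewrite !inE => /or3P[|| /or3P[]] /eqP ->.
(* Each witness violates only the inequality of its own facet, and by exactly one; the entries
   [3 * k.+1] are large enough for the others. *)
- exists (mnm4 (3 * k.+1) k 0 (3 * k.+1)) => m.
  by rewrite mnm_in_facetsE !mnmDE !mnmE /= /weight !big_cons big_nil; lia.
- exists (mnm4 (3 * k.+1) k (3 * k.+1) 0) => m.
  by rewrite mnm_in_facetsE !mnmDE !mnmE /= /weight !big_cons big_nil; lia.
- exists (mnm4 (3 * k.+1) (3 * k.+1) k 0) => m.
  by rewrite mnm_in_facetsE !mnmDE !mnmE /= /weight !big_cons big_nil; lia.
(* The inequality b + c >= k + 1 reads 2k >= k + 1, so the power [k.+1] must be at least 2. *)
- exists (mnm4 (3 * k.+1) k k 1) => m.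
  by rewrite mnm_in_facetsE !mnmDE !mnmE /= /weight !big_cons big_nil; lia.
- by exists (socle_mnm k) => m; apply: socle_mnmP.
Qed.

(** A primary decomposition of I itself without a component for (x_2, x_3, x_4), which excludes this
    prime from Ass(I). *)
Definition reduced_facets : seq (seq 'I_4 * nat) :=
  [:: ([:: i1; i2], 1); ([:: i1; i3], 1); ([:: i2; i3], 1);
      ([:: i0; i1; i2; i3], 3)].

Lemma Ass_I P : Ass (ideal_pow (ideal_span I_gens) 1) P ->
  exists2 A, A \in unzip1 reduced_facets & forall f, P f <-> order_ge A 1 f.
Proof.
move=> AP; apply: Ass_in_orders; apply: Ass_ext AP => f.
rewrite Ipow_inE !in_ordersE; suff /eq_all -> :
  mnm_in_orders (scale 1 facets) =1 mnm_in_orders reduced_facets by [].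
move=> m; rewrite mnm_in_facets1E /mnm_in_orders /= /weight !big_cons !big_nil.
lia.
Qed.

Lemma astab_I : is_astab (ideal_span I_gens) 2.
Proof.
split=> [|k1 [k1_gt0 stab]].
  by split=> // k k_ge2 P; rewrite !Ass_pow_I.
rewrite ltnNge; apply/negP => k1_le1.
have k1E : k1 = 1 by apply/eqP; rewrite eqn_leq k1_le1.
(* The prime (x_2, x_3, x_4) is associated to I^2; stability from 1 on would make it associated to
   I. *)
pose P (f : {mpoly K[4]}) : Prop := order_ge [:: i1; i2; i3] 1 f.
have /Ass_I[A A1 defP] : Ass (ideal_pow (ideal_span I_gens) 1) P.
  move: stab; rewrite k1E => /(_ 2 isT P)[stab _]; apply: stab.
  by apply/Ass_pow_I => //; exists [:: i1; i2; i3].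
(* The variables in [P] determine the set of entries of [A], and no entry of [reduced_facets]
   matches. *)
have memP i : (i \in [:: i1; i2; i3]) = (i \in A).
  have /Bool.eq_iff_eq_true := defP 'X_i.
  by rewrite !order_geX !weight1 -!has_count !has_pred1.
by move: A1 (memP i0) (memP i1) (memP i2) (memP i3);
  rewrite !inE => /or4P[] /eqP ->.
Qed.

End PowersOfI.

Theorem mainTheorem2 (K : fieldType) :
  let x1 : {mpoly K[4]} := 'X_(@Ordinal 4 0 isT) in
  let x2 : {mpoly K[4]} := 'X_(@Ordinal 4 1 isT) in
  let x3 : {mpoly K[4]} := 'X_(@Ordinal 4 2 isT) in
  let x4 : {mpoly K[4]} := 'X_(@Ordinal 4 3 isT) in
  let I := ideal_span (fun f => f \in
    [:: x1 * x2 * x3; x2 ^+ 2 * x3; x2 * x3 ^+ 2;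
        x1 * x2 * x4; x2 ^+ 2 * x4; x2 * x4 ^+ 2;
        x1 * x3 * x4; x3 ^+ 2 * x4; x3 * x4 ^+ 2;
        x2 * x3 * x4]) in
  [/\ polymatroidal I, is_dstab I 1 & is_astab I 2].
Proof.
(* Each product becomes a single monomial ['X_[u]], so the generating set is [I_gens] up to
   conversion. *)
move=> x1 x2 x3 x4 I; rewrite /I /x1 /x2 /x3 /x4 !mpolyXn -!mpolyXD.
by split; [apply: polymatroidal_I | apply: dstab_I | apply: astab_I].
Qed.
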